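(* Every symmetric anti-Leibniz algebra $(A,\cdot)$ is an $\mathcal{A}\mathrm{BD}$-algebra. Moreover, a left (respectively, right) anti-Leibniz algebra $(A,\cdot)$ is an $\mathcal{A}\mathrm{BD}$-algebra if and only if it is a Jacobi-Jordan-admissible algebra.
   Context: All algebras are over $\mathbb{C}$; an algebra $(A,\cdot)$ is a vector space with a bilinear (not necessarily associative) multiplication. Write $x\circ y = x\cdot y+y\cdot x$. An algebra is left anti-Leibniz if $x\cdot(y\cdot z)=-(x\cdot y)\cdot z-y\cdot(x\cdot z)$ for all $x,y,z$; right anti-Leibniz if $(y\cdot z)\cdot x=-(y\cdot x)\cdot z-y\cdot(z\cdot x)$ for all $x,y,z$; symmetric anti-Leibniz if it is both. A Jacobi-Jordan algebra is a commutative algebra satisfying the Jacobi identity $x(yz)+y(zx)+z(xy)=0$; $(A,\cdot)$ is Jacobi-Jordan-admissible if $(A,\circ)$ is a Jacobi-Jordan algebra. An algebra $(A,\cdot)$ is called an $\mathcal{A}\mathrm{BD}$-algebra (algebra of anti-biderivation-type) if for all $x,y,z\in A$: $x\cdot(y\circ z) = -\big((x\cdot y)\circ z+y\circ(x\cdot z)\big)$ and $(y\circ z)\cdot x=-\big((y\cdot x)\circ z+y\circ(z\cdot x)\big)$. *)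

(* Defs.v *)
From HB Require Import structures.
From mathcomp Require Import all_boot all_order all_algebra.
From mathcomp Require Import reals complex.

Set Implicit Arguments.
Unset Strict Implicit.
Unset Printing Implicit Defensive.

Import GRing.Theory.
Local Open Scope ring_scope.

(* The complex numbers are [R[i]] with [R : realType].  A complex algebra, not
   necessarily associative, commutative, unital or finite-dimensional, is an
   [R[i]]-module [A] with a product [mul : {bilinear A -> A -> A}]. *)
Section Algebras.
Variables (R : realType) (A : lmodType R[i]).
Implicit Type mul : {bilinear A -> A -> A}.

Definition left_anti_leibniz mul : Prop :=
  forall x y z : A,
    mul x (mul y z) = - mul (mul x y) z - mul y (mul x z).

Definition right_anti_leibniz mul : Prop :=
  forall x y z : A,
    mul (mul y z) x = - mul (mul y x) z - mul y (mul z x).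

Definition symmetric_anti_leibniz mul : Prop :=
  left_anti_leibniz mul /\ right_anti_leibniz mul.

Definition circ mul (x y : A) : A := mul x y + mul y x.

Fact circ_is_bilinear mul :
  bilinear_for (GRing.Scale.Law.clone _ _ *:%R _)
               (GRing.Scale.Law.clone _ _ *:%R _) (circ mul).
Proof.
by split=> u a x y /=; rewrite /circ linearPl linearPr /= scalerDr addrACA.
Qed.

(* With this instance, [circ mul] is itself an algebra product on [A]. *)
HB.instance Definition _ mul :=
  bilinear_isBilinear.Build _ A A A _ _ (circ mul) (circ_is_bilinear mul).

Definition jacobi_jordan mul : Prop :=
  (forall x y : A, mul x y = mul y x) /\
  (forall x y z : A,
    mul x (mul y z) + mul y (mul z x) + mul z (mul x y) = 0).

Definition jacobi_jordan_admissible mul : Prop := jacobi_jordan (circ mul).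

(* Anti-biderivation type: left and right multiplications are anti-derivations
   of [circ mul]. *)
Definition abd_algebra mul : Prop :=
  forall x y z : A,
    mul x (circ mul y z) = - (circ mul (mul x y) z + circ mul y (mul x z)) /\
    mul (circ mul y z) x = - (circ mul (mul y x) z + circ mul y (mul z x)).

End Algebras.

(* Main.v *)
(** The Jacobi sum of [circ mul] at [x, y, z] is the sum of the two defects
    measuring how far left and right multiplication by [x] are from being
    anti-derivations of [circ mul].  An anti-derivation of [mul] is one of
    [circ mul], so the left (right) anti-Leibniz law cancels the left (right)
    defect, and then the Jacobi sum is exactly the other defect. *)
Require Import Defs.
From mathcomp Require Import all_boot all_order all_algebra.
From mathcomp Require Import reals complex.

Import GRing.Theory.
Local Open Scope ring_scope.

Section AntiLeibniz.
Variables (R : realType) (A : lmodType R[i]) (mul : {bilinear A -> A -> A}).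

Definition left_defect (x y z : A) : A :=
  mul x (circ mul y z) + (circ mul (mul x y) z + circ mul y (mul x z)).

Definition right_defect (x y z : A) : A :=
  mul (circ mul y z) x + (circ mul (mul y x) z + circ mul y (mul z x)).

Lemma circC (x y : A) : circ mul x y = circ mul y x.
Proof. exact: addrC. Qed.

(** Each left product by [x] on the right-hand side has a mirror right product; by bilinearity every
    such pair merges into a [circ] product with [x]. *)
Lemma jacobi_circE (x y z : A) :
  circ mul x (circ mul y z) + circ mul y (circ mul z x)
    + circ mul z (circ mul x y) = left_defect x y z + right_defect x y z.
Proof.
rewrite /left_defect /right_defect [RHS]addrACA -/(circ mul x (circ mul y z)).
rewrite [X in _ = _ + X]addrACA -linearDl -linearDr /=.
rewrite -/(circ mul x y) -/(circ mul x z).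
(* The right-hand side is now the Jacobi sum in derivation form; commutativity of [circ mul] makes
   it cyclic. *)
by rewrite (circC z (circ mul x y)) (circC z x) -addrA [X in _ + X]addrC.
Qed.

Lemma abd_algebraE :
  abd_algebra mul <->
  forall x y z, left_defect x y z = 0 /\ right_defect x y z = 0.
Proof.
split=> abd x y z; have [lP rP] := abd x y z.
  by rewrite /left_defect /right_defect lP rP !addNr.
by split; apply/eqP; rewrite -addr_eq0; apply/eqP.
Qed.

(** Commutativity of [circ mul] is automatic, so only the Jacobi identity has content. *)
Lemma jacobi_jordan_admissibleE :
  jacobi_jordan_admissible mul <->
  forall x y z, left_defect x y z + right_defect x y z = 0.
Proof.
split=> [[_ jac] x y z|jac]; first by rewrite -jacobi_circE jac.
by split=> [x y|x y z]; [exact: circC | rewrite /= jacobi_circE; exact: jac].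
Qed.

(** Add the law at [x, y, z] to the law at [x, z, y]: the four resulting terms pair up into the two
    [circ] products. *)
Lemma left_defect0 : left_anti_leibniz mul ->
  forall x y z, left_defect x y z = 0.
Proof.
move=> aL x y z; rewrite /left_defect.
apply/eqP; rewrite addr_eq0 /circ linearDr /= (aL x y z) (aL x z y) -!opprD.
by rewrite [in eqbRHS]addrACA [X in _ == - (_ + X)]addrC.
Qed.

Lemma right_defect0 : right_anti_leibniz mul ->
  forall x y z, right_defect x y z = 0.
Proof.
move=> aR x y z; rewrite /right_defect.
apply/eqP; rewrite addr_eq0 /circ linearDl /= (aR x y z) (aR x z y) -!opprD.
by rewrite [in eqbRHS]addrACA [X in _ == - (_ + X)]addrC.
Qed.

End AntiLeibniz.

Theorem proposition41 (R : realType) (A : lmodType R[i])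
    (mul : {bilinear A -> A -> A}) :
  (symmetric_anti_leibniz mul -> abd_algebra mul) /\
  (left_anti_leibniz mul ->
     (abd_algebra mul <-> jacobi_jordan_admissible mul)) /\
  (right_anti_leibniz mul ->
     (abd_algebra mul <-> jacobi_jordan_admissible mul)).
Proof.
split=> [[/left_defect0 l0 /right_defect0 r0]|]; first exact/abd_algebraE.
(* It remains to compare the vanishing of both defects with the vanishing of their sum. *)
rewrite abd_algebraE jacobi_jordan_admissibleE.
split=> [/left_defect0 l0|/right_defect0 r0]; split=> H x y z.
- by have [-> ->] := H x y z; rewrite addr0.
- by have := H x y z; rewrite l0 add0r.
- by have [-> ->] := H x y z; rewrite addr0.
- by have := H x y z; rewrite r0 addr0.
Qed.
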